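(* Let $C$ be a commutative ring with identity and let $\lambda\in C$. Then the sextuple $\mathcal{A}_\lambda=(A_\lambda,\mu_\lambda,\eta_\lambda,\Delta_\lambda,\varepsilon_\lambda,S_\lambda)$ defined in the context is a Hopf algebra over $C$ (with multiplication $\mu_\lambda$, unit map $\eta_\lambda$, comultiplication $\Delta_\lambda$, counit $\varepsilon_\lambda$ and antipode $S_\lambda$).
   Context: $C$ is a commutative ring (algebra) with identity $\mathbf{1}$, and $\lambda\in C$. All tensor products are over $C$. For any integer $x$ (positive, negative or zero) and any integer $k\ge 0$, the binomial coefficient $\binom{x}{k}$ is defined by $(1+z)^x=\sum_{k\ge 0}\binom{x}{k}z^k$; $\binom{x}{k}=0$ for $k<0$. The sextuple $\mathcal{A}_\lambda=(A,\mu,\eta,\Delta,\varepsilon,S)$ is given by the following $C$-linear data: (i) $A=A_\lambda=\bigoplus_{n\ge 0}C\,a_n$ is the free $C$-module on the set $\{a_n\}_{n\ge 0}$; (ii) $\mu:A\otimes A\to A$, $a_m\otimes a_n\mapsto\sum_{k=0}^m\lambda^k\binom{m+n-k}{m}\binom{m}{k}a_{m+n-k}$; (iii) $\eta:C\to A$, $\mathbf{1}\mapsto a_0$; (iv) $\Delta:A\to A\otimes A$, $a_n\mapsto\sum_{k=0}^n\sum_{i=0}^{n-k}(-\lambda)^k a_i\otimes a_{n-k-i}$; (v) $\varepsilon:A\to C$, $a_0\mapsto\mathbf{1}$, $a_1\mapsto\lambda\mathbf{1}$, $a_n\mapsto 0$ for $n\ge 2$; (vi) $S:A\to A$, $a_n\mapsto(-1)^n\sum_{v=0}^n\binom{n-3}{n-v}\lambda^{n-v}a_v$.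 A Hopf algebra is a bialgebra $(A,\mu,\eta,\Delta,\varepsilon)$ over $C$ together with a $C$-linear map $S:A\to A$ (the antipode) satisfying $\mu\circ(S\otimes\mathrm{id})\circ\Delta=\mu\circ(\mathrm{id}\otimes S)\circ\Delta=\eta\circ\varepsilon$. In the paper coalgebras are taken to be coassociative, counital and cocommutative. *)

(* Defs.v *)
From HB Require Import structures.
From mathcomp Require Import all_boot all_order all_algebra.
From mathcomp Require Import boolp finmap.
From mathcomp Require Import monalg.

Set Implicit Arguments.
Unset Strict Implicit.
Unset Printing Implicit Defensive.

Import GRing.Theory.
Local Open Scope ring_scope.
Local Open Scope quotient_scope.

Reserved Notation "M ⊗ N" (at level 40, left associativity).
Reserved Notation "x \ot y" (at level 40, left associativity).

(* [comPzRingType] is used throughout so that the zero ring is allowed; the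
   library's [{bilinear _ -> _ -> _}] excludes it. *)

Definition is_bilinear (C : comPzRingType) (M N P : lmodType C)
    (f : M -> N -> P) : Prop :=
  (forall y, linear (fun x => f x y)) /\ (forall x, linear (f x)).

Record bilinear_map (C : comPzRingType) (M N P : lmodType C) := BilinearMap {
  bilinear_fun :> M -> N -> P;
  bilinear_mapP : is_bilinear bilinear_fun
}.

Section BilinearMapTheory.
Variables (C : comPzRingType) (M N P : lmodType C) (f : bilinear_map M N P).

Lemma bilinDl x x' y : f (x + x') y = f x y + f x' y.
Proof. by have := (bilinear_mapP f).1 y 1 x x'; rewrite !scale1r. Qed.

Lemma bilinDr x y y' : f x (y + y') = f x y + f x y'.
Proof. by have := (bilinear_mapP f).2 x 1 y y'; rewrite !scale1r. Qed.

Lemma bilin0l y : f 0 y = 0.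
Proof. by apply: (addrI (f 0 y)); rewrite -bilinDl !addr0. Qed.

Lemma bilin0r x : f x 0 = 0.
Proof. by apply: (addrI (f x 0)); rewrite -bilinDr !addr0. Qed.

Lemma bilinZl c x y : f (c *: x) y = c *: f x y.
Proof.
by have := (bilinear_mapP f).1 y c x 0; rewrite bilin0l !addr0.
Qed.

Lemma bilinZr c x y : f x (c *: y) = c *: f x y.
Proof.
by have := (bilinear_mapP f).2 x c y 0; rewrite bilin0r !addr0.
Qed.

End BilinearMapTheory.

(* A sequence of pairs [(x_i, y_i)] stands for the formal sum of the
   [x_i \ot y_i].  [tens_eq] is the congruence generated by commutativity of
   the sum and the bilinearity relations; the tensor product is the quotient.
   Opposites are obtained by scaling by [-1], so a commutative monoid
   presentation suffices, at the price of the relation [0 \ot y = 0]. *)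

Section TensorProduct.
Variables (C : comPzRingType) (M N : lmodType C).

Inductive tens_eq : seq (M * N) -> seq (M * N) -> Prop :=
| tens_eq_refl s : tens_eq s s
| tens_eq_sym s t : tens_eq s t -> tens_eq t s
| tens_eq_trans t s u : tens_eq s t -> tens_eq t u -> tens_eq s u
| tens_eq_cat s s' t t' :
    tens_eq s s' -> tens_eq t t' -> tens_eq (s ++ t) (s' ++ t')
| tens_eq_catC s t : tens_eq (s ++ t) (t ++ s)
| tens_eq_0l y : tens_eq [:: (0, y)] [::]
| tens_eq_Dl x x' y : tens_eq [:: (x + x', y)] [:: (x, y); (x', y)]
| tens_eq_Dr x y y' : tens_eq [:: (x, y + y')] [:: (x, y); (x, y')]
| tens_eq_Z c x y : tens_eq [:: (c *: x, y)] [:: (x, c *: y)].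

Definition tens_eqb : rel (seq (M * N)) := fun s t => `[< tens_eq s t >].

Lemma tens_eqb_equiv : equiv_class_of tens_eqb.
Proof.
split=> [s|s t|t s u].
- exact/asboolP/tens_eq_refl.
- by apply/asboolP/asboolP => /tens_eq_sym.
- by move=> /asboolP st /asboolP tu; apply/asboolP/(tens_eq_trans st tu).
Qed.

Canonical tens_eqb_equivRel := EquivRelPack tens_eqb_equiv.

Definition tensor := {eq_quot tens_eqb}.
HB.instance Definition _ := Choice.on tensor.
HB.instance Definition _ : EqQuotient _ tens_eqb tensor :=
  EqQuotient.on tensor.

Lemma tens_piP s t : \pi_tensor s = \pi_tensor t <-> tens_eq s t.
Proof. by split=> [/eqmodP/asboolP|h] //; apply/eqmodP/asboolP. Qed.

Let pi_repr s : tens_eq (repr (\pi_tensor s)) s.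
Proof. by apply/tens_piP; rewrite reprK. Qed.

Definition scale_seq (c : C) (s : seq (M * N)) := [seq (c *: p.1, p.2) | p <- s].

Let scale_seq_eq c s t : tens_eq s t -> tens_eq (scale_seq c s) (scale_seq c t).
Proof.
elim=> {s t} /=.
- by move=> s; exact: tens_eq_refl.
- by move=> s t _; exact: tens_eq_sym.
- by move=> t s u _ + _; exact: tens_eq_trans.
- by move=> s s' t t' _ h _ h'; rewrite /scale_seq !map_cat; exact: tens_eq_cat.
- by move=> s t; rewrite /scale_seq !map_cat; exact: tens_eq_catC.
- by move=> y; rewrite scaler0; exact: tens_eq_0l.
- by move=> x x' y; rewrite scalerDr; exact: tens_eq_Dl.
- by move=> x y y'; exact: tens_eq_Dr.
- by move=> d x y; rewrite scalerA mulrC -scalerA; exact: tens_eq_Z.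
Qed.

Definition tens_zero : tensor := \pi_tensor [::].
Definition tens_add (t u : tensor) : tensor := \pi_tensor (repr t ++ repr u).
Definition tens_scale (c : C) (t : tensor) : tensor :=
  \pi_tensor (scale_seq c (repr t)).
Definition tens_opp : tensor -> tensor := tens_scale (- 1).

Let pi_cat s t : tens_add (\pi_tensor s) (\pi_tensor t) = \pi_tensor (s ++ t).
Proof. by apply/tens_piP/tens_eq_cat. Qed.

Let pi_scale c s : tens_scale c (\pi_tensor s) = \pi_tensor (scale_seq c s).
Proof. by apply/tens_piP/scale_seq_eq. Qed.

Let pi_surj (P : tensor -> Prop) :
  (forall s, P (\pi_tensor s)) -> forall t, P t.
Proof. by move=> h t; rewrite -[t]reprK. Qed.

Let tens_addA : associative tens_add.
Proof.
elim/pi_surj=> s; elim/pi_surj=> t; elim/pi_surj=> u.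
by rewrite !pi_cat catA.
Qed.

Let tens_addC : commutative tens_add.
Proof.
elim/pi_surj=> s; elim/pi_surj=> t; rewrite !pi_cat.
exact/tens_piP/tens_eq_catC.
Qed.

Let tens_add0 : left_id tens_zero tens_add.
Proof. by elim/pi_surj=> s; rewrite pi_cat. Qed.

Let scale_seqDl c d s :
  tens_eq (scale_seq (c + d) s) (scale_seq c s ++ scale_seq d s).
Proof.
elim: s => [|[x y] s IHs] /=; first exact: tens_eq_refl.
rewrite scalerDl.
set A := scale_seq c s; set B := scale_seq d s.
set p := (c *: x, y); set q := (d *: x, y).
apply: (@tens_eq_trans ([:: p; q] ++ (A ++ B))).
  exact: (tens_eq_cat (tens_eq_Dl _ _ _) IHs).
apply: (@tens_eq_cat [:: p] [:: p] ([:: q] ++ (A ++ B)) (A ++ ([:: q] ++ B))).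
  exact: tens_eq_refl.
rewrite !catA; apply: tens_eq_cat; last exact: tens_eq_refl.
exact: tens_eq_catC.
Qed.

Let scale_seq0 s : tens_eq (scale_seq 0 s) [::].
Proof.
elim: s => [|[x y] s IHs] /=; first exact: tens_eq_refl.
by rewrite scale0r; exact: (tens_eq_cat (tens_eq_0l y) IHs).
Qed.

Let scale_seq1 s : scale_seq 1 s = s.
Proof. by rewrite /scale_seq -[RHS]map_id; apply: eq_map => -[x y]; rewrite scale1r. Qed.

Let tens_addN : left_inverse tens_zero tens_opp tens_add.
Proof.
elim/pi_surj=> s; rewrite /tens_opp pi_scale pi_cat; apply/tens_piP.
rewrite -[X in _ ++ X]scale_seq1.
apply: tens_eq_trans (tens_eq_sym (scale_seqDl _ _ _)) _.
by rewrite addNr; exact: scale_seq0.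
Qed.

HB.instance Definition _ :=
  GRing.isZmodule.Build tensor tens_addA tens_addC tens_add0 tens_addN.

Let tens_scaleA c d t : tens_scale c (tens_scale d t) = tens_scale (c * d) t.
Proof.
elim/pi_surj: t => s; rewrite !pi_scale /scale_seq -map_comp.
by congr \pi_tensor; apply: eq_map => p /=; rewrite scalerA.
Qed.

Let tens_scale1 : left_id 1 tens_scale.
Proof. by elim/pi_surj=> s; rewrite pi_scale scale_seq1. Qed.

Let tens_scaleDr : right_distributive tens_scale +%R.
Proof.
move=> c; elim/pi_surj=> s; elim/pi_surj=> t.
by rewrite /+%R /= pi_cat !pi_scale pi_cat /scale_seq map_cat.
Qed.

Let tens_scaleDl t : {morph tens_scale^~ t : c d / c + d}.
Proof.
move=> c d; elim/pi_surj: t => s.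
by rewrite [in RHS]/+%R /= !pi_scale pi_cat; exact/tens_piP/scale_seqDl.
Qed.

HB.instance Definition _ := GRing.Zmodule_isLmodule.Build C tensor
  tens_scaleA tens_scale1 tens_scaleDr tens_scaleDl.

Definition tens (x : M) (y : N) : tensor := \pi_tensor [:: (x, y)].

Lemma tens_bilinear : is_bilinear tens.
Proof.
split=> [y c x x'|x c y y'].
- rewrite /GRing.add /GRing.scale /= pi_scale pi_cat.
  exact/tens_piP/tens_eq_Dl.
- rewrite /GRing.add /GRing.scale /= pi_scale pi_cat.
  apply/tens_piP/(tens_eq_trans (tens_eq_Dr _ _ _)).
  rewrite -cat1s; apply: tens_eq_cat; last exact: tens_eq_refl.
  exact/tens_eq_sym/tens_eq_Z.
Qed.

Lemma tens_pi_sum s : \pi_tensor s = \sum_(p <- s) tens p.1 p.2.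
Proof.
elim: s => [|[x y] s IHs]; first by rewrite big_nil.
by rewrite big_cons -IHs -cat1s -pi_cat.
Qed.

Lemma tensor_sum (t : tensor) :
  exists s : seq (M * N), t = \sum_(p <- s) tens p.1 p.2.
Proof. by exists (repr t); rewrite -tens_pi_sum reprK. Qed.

Lemma tens_eq_sum (P : lmodType C) (f : bilinear_map M N P) s t :
  tens_eq s t -> \sum_(p <- s) f p.1 p.2 = \sum_(p <- t) f p.1 p.2.
Proof.
elim=> {s t}.
- by [].
- by move=> s t _ ->.
- by move=> t s u _ -> _ ->.
- by move=> s s' t t' _ h _ h'; rewrite !big_cat /= h h'.
- by move=> s t; rewrite !big_cat /= addrC.
- by move=> y; rewrite big_seq1 big_nil bilin0l.
- by move=> x x' y; rewrite !big_cons !big_nil !addr0 bilinDl.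
- by move=> x y y'; rewrite !big_cons !big_nil !addr0 bilinDr.
- by move=> c x y; rewrite !big_seq1 bilinZl bilinZr.
Qed.

Section Lift.
Variables (P : lmodType C) (f : bilinear_map M N P).

Definition tens_lift (t : tensor) : P := \sum_(p <- repr t) f p.1 p.2.

Let tens_lift_pi s : tens_lift (\pi_tensor s) = \sum_(p <- s) f p.1 p.2.
Proof. exact: tens_eq_sum. Qed.

Lemma tens_liftE x y : tens_lift (tens x y) = f x y.
Proof. by rewrite tens_lift_pi big_seq1. Qed.

Lemma tens_lift_linear : linear tens_lift.
Proof.
move=> c; elim/pi_surj=> s; elim/pi_surj=> t.
rewrite {1}/GRing.add {1}/GRing.scale /= pi_scale pi_cat !tens_lift_pi.
rewrite big_cat /=; congr (_ + _).
rewrite big_map scaler_sumr; apply: eq_bigr => p _ /=; exact: bilinZl.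
Qed.

HB.instance Definition _ :=
  GRing.isLinear.Build C tensor P *:%R tens_lift tens_lift_linear.

Lemma tens_lift_sum (s : seq (M * N)) :
  tens_lift (\sum_(p <- s) tens p.1 p.2) = \sum_(p <- s) f p.1 p.2.
Proof. by rewrite -tens_pi_sum tens_lift_pi. Qed.

End Lift.

End TensorProduct.

Notation "M ⊗ N" := (tensor M N).
Notation "x \ot y" := (tens x y).

Section TensorTheory.
Variable C : comPzRingType.
Implicit Types M N P Q : lmodType C.

Canonical tens_bilin M N := BilinearMap (@tens_bilinear C M N).

Lemma tensDl M N (x x' : M) (y : N) : (x + x') \ot y = x \ot y + x' \ot y.
Proof. exact: (bilinDl (tens_bilin M N)). Qed.

Lemma tensDr M N (x : M) (y y' : N) : x \ot (y + y') = x \ot y + x \ot y'.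
Proof. exact: (bilinDr (tens_bilin M N)). Qed.

Lemma tensZl M N c (x : M) (y : N) : (c *: x) \ot y = c *: (x \ot y).
Proof. exact: (bilinZl (tens_bilin M N)). Qed.

Lemma tensZr M N c (x : M) (y : N) : x \ot (c *: y) = c *: (x \ot y).
Proof. exact: (bilinZr (tens_bilin M N)). Qed.

Lemma tens_ext M N P (f g : {linear M ⊗ N -> P}) :
  (forall x y, f (x \ot y) = g (x \ot y)) -> f =1 g.
Proof.
move=> fg t; have [s ->] := tensor_sum t; rewrite !linear_sum.
by apply: eq_bigr => p _; exact: fg.
Qed.

End TensorTheory.

Section TensorMaps.
Variable C : comPzRingType.

Section Map.
Variables (M M' N N' : lmodType C).
Variables (f : {linear M -> M'}) (g : {linear N -> N'}).

Fact tens_map_bilinear : is_bilinear (fun x y => f x \ot g y).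
Proof.
by split=> [y c x x'|x c y y'];
  rewrite linearP ?tensDl ?tensDr ?tensZl ?tensZr.
Qed.

Definition tens_map : M ⊗ N -> M' ⊗ N' :=
  tens_lift (BilinearMap tens_map_bilinear).
HB.instance Definition _ := GRing.Linear.on tens_map.

Lemma tens_mapE x y : tens_map (x \ot y) = f x \ot g y.
Proof. exact: tens_liftE. Qed.

End Map.

Section Swap.
Variables M N : lmodType C.

Fact tens_swap_bilinear : is_bilinear (fun (x : M) (y : N) => y \ot x).
Proof.
by split=> [y c x x'|x c y y']; rewrite ?tensDl ?tensDr ?tensZl ?tensZr.
Qed.

Definition tens_swap : M ⊗ N -> N ⊗ M :=
  tens_lift (BilinearMap tens_swap_bilinear).
HB.instance Definition _ := GRing.Linear.on tens_swap.

Lemma tens_swapE x y : tens_swap (x \ot y) = y \ot x.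
Proof. exact: tens_liftE. Qed.

End Swap.

Section Assoc.
Variables M N P : lmodType C.

Fact tens_assoc_bilinear1 (z : P) :
  is_bilinear (fun (x : M) (y : N) => x \ot (y \ot z)).
Proof.
by split=> [y c x x'|x c y y']; rewrite ?(tensDl, tensDr, tensZl, tensZr).
Qed.

Fact tens_assoc_bilinear :
  is_bilinear (fun t z => tens_lift (BilinearMap (tens_assoc_bilinear1 z)) t).
Proof.
split=> [z c t t'|t c z z']; first by rewrite linearP.
have [s ->] := tensor_sum t; rewrite !tens_lift_sum scaler_sumr -big_split /=.
by apply: eq_bigr => p _; rewrite !(tensDr, tensZr).
Qed.

Definition tens_assoc : (M ⊗ N) ⊗ P -> M ⊗ (N ⊗ P) :=
  tens_lift (BilinearMap tens_assoc_bilinear).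
HB.instance Definition _ := GRing.Linear.on tens_assoc.

Lemma tens_assocE x y z : tens_assoc ((x \ot y) \ot z) = x \ot (y \ot z).
Proof. by rewrite /tens_assoc !tens_liftE /= tens_liftE. Qed.

Fact tens_assocV_bilinear1 (x : M) :
  is_bilinear (fun (y : N) (z : P) => (x \ot y) \ot z).
Proof.
by split=> [z c y y'|y c z z']; rewrite ?(tensDl, tensDr, tensZl, tensZr).
Qed.

Fact tens_assocV_bilinear :
  is_bilinear (fun x t => tens_lift (BilinearMap (tens_assocV_bilinear1 x)) t).
Proof.
split=> [t c x x'|x c t t']; last by rewrite linearP.
have [s ->] := tensor_sum t; rewrite !tens_lift_sum scaler_sumr -big_split /=.
by apply: eq_bigr => p _; rewrite !(tensDl, tensZl).
Qed.

Definition tens_assocV : M ⊗ (N ⊗ P) -> (M ⊗ N) ⊗ P :=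
  tens_lift (BilinearMap tens_assocV_bilinear).
HB.instance Definition _ := GRing.Linear.on tens_assocV.

Lemma tens_assocVE x y z : tens_assocV (x \ot (y \ot z)) = (x \ot y) \ot z.
Proof. by rewrite /tens_assocV !tens_liftE /= tens_liftE. Qed.

End Assoc.

Section Unitors.
Variable M : lmodType C.

Fact tens_lunit_bilinear : is_bilinear (fun (c : C^o) (x : M) => c *: x).
Proof.
split=> [x c d d'|c d x x'] /=; first by rewrite scalerDl scalerA.
by rewrite scalerDr !scalerA mulrC.
Qed.

Definition tens_lunit : C^o ⊗ M -> M :=
  tens_lift (BilinearMap tens_lunit_bilinear).
HB.instance Definition _ := GRing.Linear.on tens_lunit.

Lemma tens_lunitE c x : tens_lunit (c \ot x) = c *: x.
Proof. exact: tens_liftE. Qed.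

Definition tens_runit : M ⊗ C^o -> M := tens_lunit \o @tens_swap M C^o.
HB.instance Definition _ := GRing.Linear.on tens_runit.

Lemma tens_runitE x c : tens_runit (x \ot c) = c *: x.
Proof. by rewrite /tens_runit /= tens_swapE tens_lunitE. Qed.

End Unitors.

Definition tens_interchange (M N P Q : lmodType C) :
    (M ⊗ N) ⊗ (P ⊗ Q) -> (M ⊗ P) ⊗ (N ⊗ Q) :=
  @tens_assocV M P (N ⊗ Q)
  \o tens_map idfun (@tens_assoc P N Q)
  \o tens_map idfun (tens_map (@tens_swap N P) idfun)
  \o tens_map idfun (@tens_assocV N P Q)
  \o @tens_assoc M N (P ⊗ Q).
HB.instance Definition _ M N P Q := GRing.Linear.on (@tens_interchange M N P Q).

Lemma tens_interchangeE (M N P Q : lmodType C) (x : M) (y : N) (z : P) (t : Q) :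
  tens_interchange ((x \ot y) \ot (z \ot t)) = (x \ot z) \ot (y \ot t).
Proof.
rewrite /tens_interchange /= tens_assocE !tens_mapE /= tens_assocVE.
by rewrite !tens_mapE /= tens_swapE tens_assocE tens_assocVE.
Qed.

End TensorMaps.

Section HopfAlgebra.
Variable C : comPzRingType.

Record is_algebra (A : lmodType C)
    (mu : {linear A ⊗ A -> A}) (eta : {linear C^o -> A}) : Prop := {
  alg_assoc : forall t : (A ⊗ A) ⊗ A,
    mu (tens_map mu idfun t) = mu (tens_map idfun mu (tens_assoc t));
  alg_unitl : forall t : C^o ⊗ A, mu (tens_map eta idfun t) = tens_lunit t;
  alg_unitr : forall t : A ⊗ C^o, mu (tens_map idfun eta t) = tens_runit t
}.

Record is_cocommutative_coalgebra (A : lmodType C)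
    (Delta : {linear A -> A ⊗ A}) (eps : {linear A -> C^o}) : Prop := {
  coalg_coassoc : forall x,
    tens_assoc (tens_map Delta idfun (Delta x)) = tens_map idfun Delta (Delta x);
  coalg_counitl : forall x, tens_lunit (tens_map eps idfun (Delta x)) = x;
  coalg_counitr : forall x, tens_runit (tens_map idfun eps (Delta x)) = x;
  coalg_cocomm : forall x, tens_swap (Delta x) = Delta x
}.

Record is_algebra_morphism (A B : lmodType C)
    (muA : {linear A ⊗ A -> A}) (etaA : {linear C^o -> A})
    (muB : {linear B ⊗ B -> B}) (etaB : {linear C^o -> B})
    (f : {linear A -> B}) : Prop := {
  alg_morphM : forall t : A ⊗ A, f (muA t) = muB (tens_map f f t);
  alg_morph1 : forall c : C^o, f (etaA c) = etaB c
}.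

(* The multiplication of C; its unit map is the identity. *)
Definition scalar_mul : C^o ⊗ C^o -> C^o := @tens_lunit C C^o.
HB.instance Definition _ := GRing.Linear.on scalar_mul.

Section TensorAlgebra.
Variables (A : lmodType C).
Variables (mu : {linear A ⊗ A -> A}) (eta : {linear C^o -> A}).

Definition tens_mul : (A ⊗ A) ⊗ (A ⊗ A) -> A ⊗ A :=
  tens_map mu mu \o @tens_interchange C A A A A.
HB.instance Definition _ := GRing.Linear.on tens_mul.

Definition tens_one (c : C^o) : A ⊗ A := (c : C) *: (eta 1 \ot eta 1).

Fact tens_one_linear : linear tens_one.
Proof. by move=> c d e; rewrite /tens_one scalerDl scalerA. Qed.

HB.instance Definition _ :=
  GRing.isLinear.Build C C^o (A ⊗ A) *:%R tens_one tens_one_linear.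

End TensorAlgebra.

Record is_bialgebra (A : lmodType C)
    (mu : {linear A ⊗ A -> A}) (eta : {linear C^o -> A})
    (Delta : {linear A -> A ⊗ A}) (eps : {linear A -> C^o}) : Prop := {
  bialg_alg : is_algebra mu eta;
  bialg_coalg : is_cocommutative_coalgebra Delta eps;
  bialg_comul : is_algebra_morphism mu eta (tens_mul mu) (tens_one eta) Delta;
  bialg_counit : is_algebra_morphism mu eta scalar_mul idfun eps
}.

Record is_Hopf_algebra (A : lmodType C)
    (mu : {linear A ⊗ A -> A}) (eta : {linear C^o -> A})
    (Delta : {linear A -> A ⊗ A}) (eps : {linear A -> C^o})
    (S : {linear A -> A}) : Prop := {
  hopf_bialg : is_bialgebra mu eta Delta eps;
  hopf_antipodel : forall x, mu (tens_map S idfun (Delta x)) = eta (eps x);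
  hopf_antipoder : forall x, mu (tens_map idfun S (Delta x)) = eta (eps x)
}.

End HopfAlgebra.

(* The carrier is the type of finitely supported functions of [monalg], whose
   own [lmodType] instance requires [1 != 0]. *)

Section FreeModule.
Variables (C : comPzRingType) (I : choiceType).

Definition free_module : Type := {malg C[I]}.
HB.instance Definition _ := GRing.Zmodule.on free_module.

Definition free_scale (c : C) (x : free_module) : free_module :=
  [malg i in msupp x => c * x@_i].

Let free_scaleE c x i : (free_scale c x)@_i = c * x@_i.
Proof. by rewrite mcoeffE; case: msuppP => //; rewrite mulr0. Qed.

Let free_scaleA c d x : free_scale c (free_scale d x) = free_scale (c * d) x.
Proof. by apply/malgP => i; rewrite !free_scaleE mulrA. Qed.

Let free_scale1 : left_id 1 free_scale.
Proof. by move=> x; apply/malgP => i; rewrite free_scaleE mul1r. Qed.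

Let free_scaleDr : right_distributive free_scale +%R.
Proof.
by move=> c x y; apply/malgP => i; rewrite !(free_scaleE, mcoeffD) mulrDr.
Qed.

Let free_scaleDl x : {morph free_scale^~ x : c d / c + d}.
Proof.
by move=> c d; apply/malgP => i; rewrite !(free_scaleE, mcoeffD) mulrDl.
Qed.

HB.instance Definition _ := GRing.Zmodule_isLmodule.Build C free_module
  free_scaleA free_scale1 free_scaleDr free_scaleDl.

Lemma free_coefZ c (x : free_module) i : (c *: x)@_i = c * x@_i.
Proof. exact: free_scaleE. Qed.

Definition free_basis (i : I) : free_module := << 1 *g i >>.

Lemma free_basis_sum (x : free_module) :
  x = \sum_(i <- msupp x) x@_i *: free_basis i.
Proof.
rewrite {1}[x]monalgE; apply: eq_bigr => i _; apply/malgP => j.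
by rewrite free_coefZ !mcoeffU mulrnAr mulr1.
Qed.

Section Extension.
Variables (V : lmodType C) (F : I -> V).

Definition free_ext (x : free_module) : V := \sum_(i <- msupp x) x@_i *: F i.

Let free_extw (d : {fset I}) x : (msupp x `<=` d)%fset ->
  free_ext x = \sum_(i <- d) x@_i *: F i.
Proof.
move=> le_d; rewrite /free_ext (big_fset_incl _ le_d) //= => i _ /mcoeff_outdom ->.
by rewrite scale0r.
Qed.

Lemma free_ext_linear : linear free_ext.
Proof.
move=> c x y; pose d := (msupp (c *: x + y) `|` msupp x `|` msupp y)%fset.
have sub : [/\ msupp (c *: x + y) `<=` d, msupp x `<=` d & msupp y `<=` d]%fset.
  by split; apply/fsubsetP => i; rewrite !inE => ->; rewrite ?orbT.
case: sub => h1 h2 h3; rewrite !(@free_extw d) // scaler_sumr -big_split /=.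
by apply: eq_bigr => i _; rewrite mcoeffD free_coefZ scalerDl scalerA.
Qed.

HB.instance Definition _ :=
  GRing.isLinear.Build C free_module V *:%R free_ext free_ext_linear.

Lemma free_extE i : free_ext (free_basis i) = F i.
Proof.
rewrite (@free_extw [fset i]%fset) ?msuppU_le // big_seq_fset1.
by rewrite mcoeffUU scale1r.
Qed.

End Extension.

Lemma free_ext_unique (V : lmodType C) (f g : {linear free_module -> V}) :
  (forall i, f (free_basis i) = g (free_basis i)) -> f =1 g.
Proof.
move=> fg x; rewrite [x]free_basis_sum !linear_sum.
by apply: eq_bigr => i _; rewrite !linearZ fg.
Qed.

End FreeModule.

Section FreeModuleBilinear.
Variables (C : comPzRingType) (I J : choiceType) (V : lmodType C).
Variable F : I -> J -> V.

Fact free_ext2_bilinear : is_bilinear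
  (fun (x : free_module C I) (y : free_module C J) =>
     free_ext (fun i => free_ext (F i) y) x).
Proof.
split=> [y c x x'|x c y y']; first by rewrite linearP.
rewrite /free_ext scaler_sumr -big_split /=; apply: eq_bigr => i _.
by rewrite -/(free_ext (F i) _) linearP scalerDr !scalerA mulrC.
Qed.

Definition tens_free_ext : free_module C I ⊗ free_module C J -> V :=
  tens_lift (BilinearMap free_ext2_bilinear).
HB.instance Definition _ := GRing.Linear.on tens_free_ext.

Lemma tens_free_extE i j :
  tens_free_ext (free_basis C i \ot free_basis C j) = F i j.
Proof. by rewrite /tens_free_ext tens_liftE /= !free_extE. Qed.

End FreeModuleBilinear.

(* Formal power series over [int] are given by their coefficients. *)
Definition ps_mul (f g : nat -> int) (k : nat) : int :=
  \sum_(i < k.+1) f i * g (k - i)%N.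
Definition ps_one (k : nat) : int := (k == 0)%:R.
Definition ps_1Dz (k : nat) : int := (k <= 1)%:R.
Definition ps_1Dz_inv (k : nat) : int := (-1) ^+ k.

Lemma ps_1Dz_invK : ps_mul ps_1Dz ps_1Dz_inv =1 ps_one.
Proof.
case=> [|k]; rewrite /ps_mul; first by rewrite big_ord_recl big_ord0.
rewrite !big_ord_recl big1 ?addr0 /=; last by move=> i _; rewrite mul0r.
by rewrite /ps_1Dz_inv /bump /= !mul1r subn0 subn1 exprS mulN1r addNr.
Qed.

(* The power series (1 + z)^x for an integer x. *)
Definition ps_1Dz_exp (x : int) : nat -> int :=
  match x with
  | Posz n => iter n (ps_mul ps_1Dz) ps_one
  | Negz n => iter n.+1 (ps_mul ps_1Dz_inv) ps_one
  end.

(* The binomial coefficient "x choose k" is the coefficient of z^k in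
   (1 + z)^x; see [binz_nat] and [binz_neg] for closed forms. *)
Definition binz (x : int) (k : nat) : int := ps_1Dz_exp x k.

Lemma binz_nat (n k : nat) : binz n%:Z k = 'C(n, k)%:Z.
Proof.
rewrite /binz /=; elim: n k => [|n IHn] [|k] //=; rewrite /ps_mul.
  by rewrite big_ord1 IHn mul1r !bin0.
rewrite !big_ord_recl big1 ?addr0 /=; last by move=> i _; rewrite mul0r.
by rewrite /bump /= !mul1r !IHn subn0 subn1 binS PoszD.
Qed.

Lemma binz_neg (n k : nat) : binz (Negz n) k = (-1) ^+ k * 'C(n + k, k)%:Z.
Proof.
rewrite /binz /=; elim: n k => [|n IHn] k.
  rewrite /= /ps_mul big_ord_recr /= subnn mulr1 big1 ?add0r ?add0n ?binn ?mulr1 //.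
  by move=> i _; rewrite /ps_one subn_eq0 leqNgt ltn_ord mulr0.
rewrite iterS {1}/ps_mul.
have -> : 'C(n.+1 + k, k) = (\sum_(i < k.+1) 'C(n + i, i))%N.
  elim: k => [|k IHk]; first by rewrite big_ord1 !bin0.
  by rewrite big_ord_recr /= -IHk addSn binS addnC -addSnnS.
rewrite (big_morph Posz PoszD (erefl _)) mulr_sumr.
rewrite [LHS](reindex_inj rev_ord_inj) /=; apply: eq_bigr => i _.
have le_ik : (i <= k)%N by rewrite -ltnS.
by rewrite subSS subKn // IHn mulrA /ps_1Dz_inv -exprD subnK.
Qed.

Section HopfLambda.
Variables (C : comPzRingType) (lambda : C).

Definition A_lam : lmodType C := free_module C nat.
Definition a_ (n : nat) : A_lam := free_basis C n.

(* Both upper arguments of the binomials are natural numbers here, as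
   [k <= m]; only the antipode needs [binz]. *)
Definition mu_lam : {linear A_lam ⊗ A_lam -> A_lam} :=
  tens_free_ext (fun m n : nat =>
    \sum_(k < m.+1)
      (lambda ^+ k * ('C(m + n - k, m))%:R * ('C(m, k))%:R) *: a_ (m + n - k)).

Definition eta_lam (c : C^o) : A_lam := (c : C) *: a_ 0.

Fact eta_lam_linear : linear eta_lam.
Proof. by move=> c d e; rewrite /eta_lam scalerDl scalerA. Qed.

HB.instance Definition _ :=
  GRing.isLinear.Build C C^o A_lam *:%R eta_lam eta_lam_linear.

Definition Delta_lam : {linear A_lam -> A_lam ⊗ A_lam} :=
  free_ext (fun n : nat =>
    \sum_(k < n.+1) \sum_(i < (n - k).+1)
      (- lambda) ^+ k *: (a_ i \ot a_ (n - k - i))).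

Definition eps_lam : {linear A_lam -> C^o} :=
  free_ext (fun n : nat =>
    match n with 0 => 1 | 1 => lambda | _ => 0 end : C^o).

Definition S_lam : {linear A_lam -> A_lam} :=
  free_ext (fun n : nat =>
    (-1) ^+ n *: \sum_(v < n.+1)
      ((binz (n%:Z - 3) (n - v))%:~R * lambda ^+ (n - v)) *: a_ v).

End HopfLambda.

(* Main.v *)
(* Write a(t) = sum_n a_n t^n.  The definitions say a(s) a(t) = a(s + t + lambda s t)
   and Delta a(t) = (a(t) \ot a(t)) / (1 + lambda t), so b(t) = a(t) / (1 + lambda t)
   is grouplike with b(s) b(t) = b(s + t + lambda s t).  Its coefficients are
   b_n = Q^n(1), where Q is the shift b_n |-> b_(n+1); this Q is a Rota-Baxter
   operator of weight lambda, and
     Delta (Q x) = 1 \ot Q x + (Q \ot id) (Delta x),  eps (Q x) = 0,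
     S (Q x) = lambda eps(x) 1 - Q (S x) - lambda (S x).
   As 1 generates A under Q, every Hopf algebra axiom follows from these
   identities by induction on the number of applications of Q. *)

Require Import Defs.
From mathcomp Require Import all_boot all_order all_algebra.
From mathcomp Require Import zify.

Set Implicit Arguments.
Unset Strict Implicit.
Unset Printing Implicit Defensive.

Import GRing.Theory.
Local Open Scope ring_scope.

(** * Induction principles for tensor products and free modules *)

Lemma tens0l (C : comPzRingType) (M N : lmodType C) (y : N) :
  (0 : M) \ot y = 0.
Proof. exact: (bilin0l (tens_bilin M N)). Qed.

Lemma tens0r (C : comPzRingType) (M N : lmodType C) (x : M) :
  x \ot (0 : N) = 0.
Proof. exact: (bilin0r (tens_bilin M N)). Qed.

Lemma tens_ind (C : comPzRingType) (M N : lmodType C) (P : M ⊗ N -> Prop) :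
  P 0 -> (forall s t, P s -> P t -> P (s + t)) ->
  (forall x y, P (x \ot y)) -> forall t, P t.
Proof.
move=> P0 PD Pt t; have [s ->] := tensor_sum t.
by apply: (big_ind P) => // i _; exact: Pt.
Qed.

Lemma free_module_ind (C : comPzRingType) (I : choiceType)
    (P : free_module C I -> Prop) :
  (forall c x, P x -> P (c *: x)) -> (forall x y, P x -> P y -> P (x + y)) ->
  P 0 -> (forall i, P (free_basis C i)) -> forall x, P x.
Proof.
move=> PZ PD P0 Pb x; rewrite [x]free_basis_sum.
by apply: (big_ind P) => // i _; apply/PZ/Pb.
Qed.

(** * Bilinear products and Rota-Baxter operators *)

Section Products.
Variables (C : comPzRingType) (A : lmodType C) (mu : {linear A ⊗ A -> A}).
Local Notation "x ** y" := (mu (x \ot y)) (at level 40, left associativity).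

Lemma mulDa x y z : (x + y) ** z = x ** z + y ** z.
Proof. by rewrite tensDl linearD. Qed.

Lemma mulaD x y z : x ** (y + z) = x ** y + x ** z.
Proof. by rewrite tensDr linearD. Qed.

Lemma mulZa c x y : (c *: x) ** y = c *: (x ** y).
Proof. by rewrite tensZl linearZ. Qed.

Lemma mulaZ c x y : x ** (c *: y) = c *: (x ** y).
Proof. by rewrite tensZr linearZ. Qed.

Lemma mulNa x y : (- x) ** y = - (x ** y).
Proof. by rewrite -scaleN1r mulZa scaleN1r. Qed.

Lemma mulaN x y : x ** (- y) = - (x ** y).
Proof. by rewrite -scaleN1r mulaZ scaleN1r. Qed.

Lemma mul0a x : 0 ** x = 0.
Proof. by rewrite tens0l linear0. Qed.

Lemma mula0 x : x ** 0 = 0.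
Proof. by rewrite tens0r linear0. Qed.

Definition rota_baxter (lam : C) (P : {linear A -> A}) : Prop :=
  forall x y, P x ** P y =
    P (x ** P y) + P (P x ** y) + lam *: P (x ** y).

Lemma tens_mulE x y z t :
  tens_mul mu ((x \ot y) \ot (z \ot t)) = (x ** z) \ot (y ** t).
Proof. by rewrite /tens_mul /= tens_interchangeE tens_mapE. Qed.

End Products.

#[local] Arguments mu_lam : simpl never.
#[local] Arguments Delta_lam : simpl never.
#[local] Arguments eps_lam : simpl never.
#[local] Arguments S_lam : simpl never.
#[local] Arguments tens_mul : simpl never.
#[local] Arguments tens_map : simpl never.

(** Both sides of the Rota-Baxter identity are bilinear in [x] and [y], so basis vectors suffice. *)
Lemma rota_baxter_free (C : comPzRingType) (I : choiceType) (lam : C)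
    (mu : {linear free_module C I ⊗ free_module C I -> free_module C I})
    (P : {linear free_module C I -> free_module C I}) :
  (forall i j, let b := @free_basis C I in
     mu (P (b i) \ot P (b j)) =
     P (mu (b i \ot P (b j))) + P (mu (P (b i) \ot b j)) +
     lam *: P (mu (b i \ot b j))) -> rota_baxter mu lam P.
Proof.
move=> RBb x y; elim/free_module_ind: x => [c x E|x z Ex Ez||i].
- by rewrite !(linearZ, mulZa) /= E !scalerDr.
- rewrite !(linearD, mulDa) /= Ex Ez.
  by rewrite [LHS]addrACA [X in X + _ = _]addrACA.
- by rewrite !(linear0, mul0a, scaler0, addr0).
elim/free_module_ind: y => [c y E|y z Ey Ez||j]; last exact: RBb.
- by rewrite !(linearZ, mulaZ) /= E !scalerDr.
- rewrite !(linearD, mulaD) /= Ey Ez.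
  by rewrite [LHS]addrACA [X in X + _ = _]addrACA.
- by rewrite !(linear0, mula0, scaler0, addr0).
Qed.

(** On pure tensors all four terms have the same second factor, the product of the second factors,
    so only the identity for [P] in the first factor remains. This serves the multiplicativity of
    [Delta], where [Q] acts on one leg. *)
Lemma rota_baxter_tens (C : comPzRingType) (A : lmodType C) (lam : C)
    (mu : {linear A ⊗ A -> A}) (P : {linear A -> A}) :
  rota_baxter mu lam P -> rota_baxter (tens_mul mu) lam (tens_map P idfun).
Proof.
move=> RB s t; elim/tens_ind: s => [|s u Es Eu|x y].
- by rewrite !(linear0, mul0a, scaler0, addr0).
- rewrite !(linearD, mulDa) /= Es Eu.
  by rewrite [LHS]addrACA [X in X + _ = _]addrACA.
elim/tens_ind: t => [|t u Et Eu|z t].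
- by rewrite !(linear0, mula0, scaler0, addr0).
- rewrite !(linearD, mulaD) /= Et Eu.
  by rewrite [LHS]addrACA [X in X + _ = _]addrACA.
by rewrite /= !(tens_mapE, tens_mulE) /= RB !tensDl tensZl.
Qed.

(** * Hopf algebras generated from the unit by a Rota-Baxter operator *)

Section RotaBaxterHopf.
Variables (C : comPzRingType) (A : lmodType C) (lam : C).
Variables (mu : {linear A ⊗ A -> A}) (eta : {linear C^o -> A}).
Variables (Delta : {linear A -> A ⊗ A}) (eps : {linear A -> C^o}).
Variables (S Q : {linear A -> A}) (one : A).

Local Notation "x ** y" := (mu (x \ot y)) (at level 40, left associativity).
Local Notation Q1 := (tens_map Q idfun).

Hypothesis Q_ind : forall P : A -> Prop,
  (forall c x y, P x -> P y -> P (c *: x + y)) -> P one ->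
  (forall x, P x -> P (Q x)) -> forall x, P x.
Hypothesis eta_one : forall c : C, eta c = c *: one.
Hypothesis mul1a : left_id one (fun x y => x ** y).
Hypothesis mula1 : right_id one (fun x y => x ** y).
Hypothesis Q_RB : rota_baxter mu lam Q.
Hypothesis Delta1 : Delta one = one \ot one.
Hypothesis DeltaQ : forall x, Delta (Q x) = one \ot Q x + Q1 (Delta x).
Hypothesis DeltaC : forall x, tens_swap (Delta x) = Delta x.
Hypothesis eps1 : eps one = 1 :> C.
Hypothesis epsQ : forall x, eps (Q x) = 0.
Hypothesis S1 : S one = one.
Hypothesis SQ : forall x, S (Q x) = (lam * eps x) *: one - Q (S x) - lam *: S x.

Lemma rb_mulA x y z : x ** y ** z = x ** (y ** z).
Proof.
elim/Q_ind: x y z => [c x x' E E' y z||x IHx y z].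
- by rewrite !(mulDa, mulZa) E E'.
- by move=> y z; rewrite !mul1a.
elim/Q_ind: y z => [c y y' E E' z||y IHy z].
- by rewrite !(mulDa, mulZa, mulaD, mulaZ) E E'.
- by move=> z; rewrite mula1 mul1a.
elim/Q_ind: z => [c z z' E E'||z IHz].
- by rewrite !(mulaD, mulaZ) E E'.
- by rewrite !mula1.
have QM u v : Q u ** Q v = Q (u ** Q v + Q u ** v + lam *: (u ** v)).
  by rewrite Q_RB !linearD linearZ.
(* Both triple products of [Q x], [Q y], [Q z] become [Q] of a sum of seven triple products. Each
   summand has lost a [Q] on at least one factor; [IHx] covers those starting with [x], [IHy] those
   starting with [Q x], [y], and [IHz] the one with [Q x], [Q y], [z]. *)
rewrite [in LHS]QM [in RHS]QM !QM -(QM x y) -(QM y z); congr (Q _).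
rewrite !(mulDa, mulZa, mulaD, mulaZ) !scalerDr IHz !IHx !IHy.
rewrite !addrA [LHS](ACl (1*2*4*6*3*5*7)); congr (_ + _).
Qed.

(** The Rota-Baxter identity is symmetric: exchanging the arguments only exchanges its first two
    terms. *)
Lemma rb_mulC x y : x ** y = y ** x.
Proof.
elim/Q_ind: x y => [c x x' E E' y|y|x IHx y].
- by rewrite !(mulDa, mulZa, mulaD, mulaZ) E E'.
- by rewrite mul1a mula1.
elim/Q_ind: y => [c y y' E E'||y IHy].
- by rewrite !(mulDa, mulZa, mulaD, mulaZ) E E'.
- by rewrite mul1a mula1.
by rewrite !Q_RB IHy !IHx; congr (_ + _); exact: addrC.
Qed.

(** A product of two elements of the range of [Q] lies again in that range, where [eps] vanishes. *)
Lemma rb_epsM x y : eps (x ** y) = (eps x : C) * eps y.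
Proof.
elim/Q_ind: x y => [c x x' E E' y|y|x IHx y].
- by rewrite mulDa mulZa !linearD !linearZ /= E E' mulrDl -mulrA.
- by rewrite mul1a eps1 mul1r.
elim/Q_ind: y => [c y y' E E'||y IHy].
- by rewrite mulaD mulaZ !linearD !linearZ /= E E' mulrDr mulrCA.
- by rewrite mula1 eps1 mulr1.
by rewrite Q_RB !linearD linearZ /= !epsQ scaler0 mulr0 !addr0.
Qed.

(** Expanding the product of the two [DeltaQ] formulas gives four terms. Multiplication by
    [one \ot z] commutes with [Q1], which settles the mixed terms; the product of the two [Q1] terms
    is expanded by the Rota-Baxter identity for [Q1]. *)
Lemma rb_DeltaM x y : Delta (x ** y) = tens_mul mu (Delta x \ot Delta y).
Proof.
have mul1t t : tens_mul mu ((one \ot one) \ot t) = t.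
  elim/tens_ind: t => [|t u Et Eu|z t].
  - by rewrite mula0.
  - by rewrite mulaD /= Et Eu.
  - by rewrite tens_mulE !mul1a.
have mult1 t : tens_mul mu (t \ot (one \ot one)) = t.
  elim/tens_ind: t => [|t u Et Eu|z t].
  - by rewrite mul0a.
  - by rewrite mulDa /= Et Eu.
  - by rewrite tens_mulE !mula1.
have mulQ1l z t :
    tens_mul mu ((one \ot z) \ot Q1 t) = Q1 (tens_mul mu ((one \ot z) \ot t)).
  elim/tens_ind: t => [|t u Et Eu|v t].
  - by rewrite !(linear0, mula0).
  - by rewrite linearD !mulaD linearD /= Et Eu.
  - by rewrite !(tens_mapE, tens_mulE) /= !mul1a.
have mulQ1r z t :
    tens_mul mu (Q1 t \ot (one \ot z)) = Q1 (tens_mul mu (t \ot (one \ot z))).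
  elim/tens_ind: t => [|t u Et Eu|v t].
  - by rewrite !(linear0, mul0a).
  - by rewrite linearD !mulDa linearD /= Et Eu.
  - by rewrite !(tens_mapE, tens_mulE) /= !mula1.
elim/Q_ind: x y => [c x x' E E' y|y|x IHx y].
- by rewrite mulDa mulZa !linearD !linearZ /= E E' mulDa mulZa.
- by rewrite mul1a Delta1 mul1t.
elim/Q_ind: y => [c y y' E E'||y IHy].
- by rewrite mulaD mulaZ !linearD !linearZ /= E E' mulaD mulaZ.
- by rewrite mula1 Delta1 mult1.
have QM u v : Q u ** Q v = Q (u ** Q v + Q u ** v + lam *: (u ** v)).
  by rewrite Q_RB !linearD linearZ.
rewrite {1}QM DeltaQ -QM !linearD linearZ /= IHy !IHx !DeltaQ.
rewrite !(mulDa, mulaD) /= tens_mulE mul1a mulQ1l mulQ1r.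
have /= -> := rota_baxter_tens Q_RB (Delta x) (Delta y).
rewrite !linearD linearZ /=.
by rewrite !addrA [LHS](ACl (1*4*2*3*5*6)).
Qed.

(** At [Q x] both iterated coproducts equal [one \ot (one \ot Q x) + one \ot Q1 (Delta x)] plus [Q]
    on the first of three legs, applied to their value at [x]. *)
Lemma rb_coassoc x :
  tens_assoc (tens_map Delta idfun (Delta x)) = tens_map idfun Delta (Delta x).
Proof.
pose QQ : A ⊗ (A ⊗ A) -> A ⊗ (A ⊗ A) := tens_map Q idfun.
have assocQ s v : tens_assoc (Q1 s \ot v) = QQ (tens_assoc (s \ot v)).
  elim/tens_ind: s => [|s u Es Eu|y z].
  - by rewrite /QQ !(linear0, tens0l).
  - by rewrite /QQ linearD /= !tensDl !linearD /= Es Eu.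
  - by rewrite /QQ tens_mapE !tens_assocE tens_mapE.
have DeltaQl t : tens_assoc (tens_map Delta idfun (Q1 t)) =
    one \ot Q1 t + QQ (tens_assoc (tens_map Delta idfun t)).
  elim/tens_ind: t => [|t u Et Eu|y z].
  - by rewrite /QQ !linear0 tens0r addr0.
  - by rewrite !linearD /= Et Eu /QQ !linearD /= tensDr; exact: addrACA.
  - rewrite !tens_mapE /= DeltaQ tensDl linearD /= assocQ.
    by rewrite tens_assocE.
have DeltaQr t : tens_map idfun Delta (Q1 t) = QQ (tens_map idfun Delta t).
  elim/tens_ind: t => [|t u Et Eu|y z].
  - by rewrite /QQ !linear0.
  - by rewrite /QQ !linearD /= Et Eu.
  - by rewrite /QQ !tens_mapE.
elim/Q_ind: x => [c x x' E E'||x IHx].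
- by rewrite !linearPZ /= E E'.
- by rewrite Delta1 !tens_mapE /= Delta1 tens_assocE.
rewrite DeltaQ !linearD /= DeltaQl DeltaQr IHx !tens_mapE /= Delta1 DeltaQ.
by rewrite tens_assocE tensDr addrA.
Qed.

(** Since [eps] kills the range of [Q], only the term [one \ot Q x] of [Delta (Q x)] survives. *)
Lemma rb_counitl x : tens_lunit (tens_map eps idfun (Delta x)) = x.
Proof.
have lunitQ t : tens_lunit (tens_map eps idfun (Q1 t)) = 0.
  elim/tens_ind: t => [|t u Et Eu|y z].
  - by rewrite !linear0.
  - by rewrite !linearD /= Et Eu addr0.
  - by rewrite !tens_mapE /= epsQ tens0l linear0.
elim/Q_ind: x => [c x x' E E'||x IHx].
- by rewrite !linearPZ /= E E'.
- by rewrite Delta1 tens_mapE /= tens_lunitE eps1 scale1r.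
by rewrite DeltaQ !linearD /= lunitQ tens_mapE tens_lunitE eps1 scale1r addr0.
Qed.

Lemma tens_map_swap (f g : {linear A -> A}) t :
  tens_map f g (tens_swap t) = tens_swap (tens_map g f t).
Proof.
elim/tens_ind: t => [|t u Et Eu|y z].
- by rewrite !linear0.
- by rewrite !linearD /= Et Eu.
- by rewrite tens_swapE !tens_mapE tens_swapE.
Qed.

Lemma mu_swap t : mu (tens_swap t) = mu t.
Proof.
elim/tens_ind: t => [|t u Et Eu|y z].
- by rewrite !linear0.
- by rewrite !linearD /= Et Eu.
- by rewrite tens_swapE rb_mulC.
Qed.

Lemma rb_counitr x : tens_runit (tens_map idfun eps (Delta x)) = x.
Proof.
have runit_swap t :
    tens_runit (tens_map idfun eps (tens_swap t)) =
    tens_lunit (tens_map eps idfun t).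
  elim/tens_ind: t => [|t u Et Eu|y z].
  - by rewrite !linear0.
  - by rewrite !linearD /= Et Eu.
  - by rewrite tens_swapE !tens_mapE tens_runitE tens_lunitE.
by rewrite -DeltaC runit_swap rb_counitl.
Qed.

(* With Phi = mu (S \ot id) Delta and M = mu (Q S \ot id) Delta, expanding
   Delta (Q x) on the left gives Phi (Q x) = Q x + lam x - M x - lam (Phi x);
   expanding it on the right and using the Rota-Baxter identity then makes all
   occurrences of Phi cancel in M (Q x) = Q (Q x + lam x). *)
Lemma rb_antipodel x : mu (tens_map S idfun (Delta x)) = eps x *: one.
Proof.
pose S1' := tens_map S (@idfun A); pose Q2 := tens_map (@idfun A) Q.
pose Phi y := mu (S1' (Delta y)); pose M y := mu (Q1 (S1' (Delta y))).
(* Cocommutativity moves [Q] from the first leg to the second. *)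
have DeltaQr y : Delta (Q y) = Q y \ot one + Q2 (Delta y).
  by rewrite -DeltaC DeltaQ linearD /= tens_swapE -tens_map_swap DeltaC.
have M1 t : mu (Q1 (S1' (Q2 t))) =
    Q (mu (S1' (Q2 t)) + mu (Q1 (S1' t)) + lam *: mu (S1' t)).
  rewrite /S1' /Q2; elim/tens_ind: t => [|t u Et Eu|y z].
  - by rewrite !(linear0, addr0).
  - rewrite ![in LHS]linearD /= Et Eu -linearD; congr (Q _).
    rewrite !linearD /=.
    by rewrite [LHS]addrACA [X in X + _ = _]addrACA.
  - by rewrite !tens_mapE /= Q_RB !linearD linearZ.
have Phi1 t : mu (S1' (Q1 t)) = lam *: tens_lunit (tens_map eps idfun t)
    - mu (Q1 (S1' t)) - lam *: mu (S1' t).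
  rewrite /S1'; elim/tens_ind: t => [|t u Et Eu|y z].
  - by rewrite !(linear0, subr0).
  - rewrite !linearD /= Et Eu ?scalerDr ?opprD.
    by rewrite [LHS]addrACA [X in X + _ = _]addrACA.
  - rewrite !tens_mapE /= SQ tens_lunitE.
    by rewrite !(mulDa, mulNa, mulZa) /= mul1a scalerA.
have PhiQ y : Phi (Q y) = Q y + lam *: y - M y - lam *: Phi y.
  rewrite {1}/Phi DeltaQ /S1' !linearD /= tens_mapE /= S1 mul1a Phi1.
  by rewrite rb_counitl !addrA.
have MQ y : M (Q y) = Q (Q y + lam *: y).
  rewrite {1}/M DeltaQr /S1' !linearD /= !tens_mapE /= mula1 M1.
  rewrite -[LHS]linearD -[RHS]linearD.
  congr (Q _); rewrite -/(Phi y) -/(M y).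
  (* The right expansion of [Phi (Q y)], solved for its second term: the two copies of [S (Q y)]
     then cancel, and [PhiQ] removes the remaining [Phi (Q y)]. *)
  have -> : mu (S1' (Q2 (Delta y))) = Phi (Q y) - S (Q y).
    by rewrite /Phi DeltaQr /S1' !linearD /= tens_mapE mula1 /= addrC addKr.
  rewrite PhiQ !addrA [LHS](ACl ((2*3)*(4*7)*(5*8)*(1*6))) /=.
  by rewrite !addNr subrr !addr0.
(* [MQ] already gives the value on the range of [Q]; the correction by [one] accounts for
   [M one = Q one], so linearity yields the formula everywhere. *)
have ME y : M y = Q y + lam *: y - (lam * eps y) *: one.
  elim/Q_ind: y => [c y y' E E'||y _]; last first.
  - by rewrite MQ epsQ mulr0 scale0r subr0 linearD linearZ.
  - rewrite /M /S1' Delta1 !tens_mapE /= S1 mula1 eps1 mulr1.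
    by rewrite addrK.
  have -> : M (c *: y + y') = c *: M y + M y'.
    by rewrite /M /S1' !linearPZ.
  rewrite E E' [Q (_ + _)]linearPZ [eps (_ + _)]linearPZ.
  rewrite mulrDr scalerDl !scalerDr scalerN !scalerA mulrCA [lam * c]mulrC opprD.
  by rewrite [LHS]addrACA [X in X + _ = _]addrACA.
rewrite -/(Phi x); elim/Q_ind: x => [c x x' E E'||x IHx].
- have -> : Phi (c *: x + x') = c *: Phi x + Phi x'.
    by rewrite /Phi /S1' !linearPZ.
  by rewrite E E' [eps (_ + _)]linearPZ scalerDl scalerA.
- by rewrite /Phi /S1' Delta1 tens_mapE mula1 /= S1 eps1 scale1r.
by rewrite PhiQ IHx ME epsQ scale0r subKr scalerA subrr.
Qed.

Lemma rb_antipoder x : mu (tens_map idfun S (Delta x)) = eps x *: one.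
Proof. by rewrite -DeltaC tens_map_swap mu_swap rb_antipodel. Qed.

Lemma rb_Hopf : is_Hopf_algebra mu eta Delta eps S.
Proof.
split; last 2 first.
- by move=> x; rewrite rb_antipodel eta_one.
- by move=> x; rewrite rb_antipoder eta_one.
split.
- split=> t.
  + elim/tens_ind: t => [|t u Et Eu|s z].
    - by rewrite !linear0.
    - by rewrite !linearD /= Et Eu.
    elim/tens_ind: s => [|s u Es Eu|x y].
    - by rewrite tens0l !linear0.
    - by rewrite tensDl !linearD /= Es Eu.
    by rewrite tens_assocE !tens_mapE /= rb_mulA.
  + elim/tens_ind: t => [|t u Et Eu|c x].
    - by rewrite !linear0.
    - by rewrite !linearD /= Et Eu.
    by rewrite tens_mapE eta_one mulZa mul1a tens_lunitE.
  + elim/tens_ind: t => [|t u Et Eu|x c].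
    - by rewrite !linear0.
    - by rewrite !linearD /= Et Eu.
    by rewrite tens_mapE eta_one mulaZ mula1 tens_runitE.
- by split; [exact: rb_coassoc|exact: rb_counitl|exact: rb_counitr|].
- split=> [t|c].
  + elim/tens_ind: t => [|t u Et Eu|x y].
    - by rewrite !linear0.
    - by rewrite !linearD /= Et Eu.
    by rewrite tens_mapE rb_DeltaM.
  + by rewrite eta_one linearZ /= Delta1 /tens_one eta_one scale1r.
- split=> [t|c].
  + elim/tens_ind: t => [|t u Et Eu|x y].
    - by rewrite !linear0.
    - by rewrite !linearD /= Et Eu.
    rewrite tens_mapE rb_epsM.
    symmetry; exact: (tens_lunitE (eps x) (eps y)).
  + by rewrite eta_one linearZ /= eps1 /GRing.scale /= mulr1.
Qed.
End RotaBaxterHopf.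

(** Since [chi] kills the range of [P], [chi (Q z) = - (lam * chi z)]. In the expanded identity for
    [Q] the multiples of [P x] and [P y] agree on both sides, and of the three multiples of [one] on
    the right, two positive and one negative, exactly the one on the left remains. This transfers
    the identity from [raise] to [shift]. *)
Lemma rota_baxter_augment (C : comPzRingType) (A : lmodType C) (lam : C)
    (mu : {linear A ⊗ A -> A}) (one : A) (P Q : {linear A -> A})
    (chi : {linear A -> C^o}) :
  left_id one (fun x y => mu (x \ot y)) ->
  right_id one (fun x y => mu (x \ot y)) ->
  (forall x y, chi (mu (x \ot y)) = (chi x : C) * chi y) ->
  chi one = 1 :> C -> (forall x, chi (P x) = 0) ->
  (forall x, Q x = P x - (lam * chi x) *: one) ->
  rota_baxter mu lam P -> rota_baxter mu lam Q.
Proof.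
move=> mul1a mula1 chiM chi1 chiP QE RB x y.
set ca : C := lam * chi x; set cb : C := lam * chi y.
have chiQ z : chi (Q z) = - (lam * chi z).
  by rewrite QE linearB linearZ /= chiP chi1 sub0r /GRing.scale /= mulr1.
have -> : Q (mu (x \ot Q y)) =
    P (mu (x \ot P y)) - cb *: P x + (ca * cb) *: one.
  rewrite QE chiM chiQ (QE y) mulaD mulaN mulaZ mula1 linearB linearZ /=.
  by rewrite !mulrN scaleNr opprK /ca !mulrA.
have -> : Q (mu (Q x \ot y)) =
    P (mu (P x \ot y)) - ca *: P y + (ca * cb) *: one.
  rewrite QE chiM chiQ (QE x) mulDa mulNa mulZa mul1a linearB linearZ /=.
  by rewrite mulNr mulrN scaleNr opprK mulrCA.
have -> : lam *: Q (mu (x \ot y)) = lam *: P (mu (x \ot y)) - (ca * cb) *: one.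
  by rewrite QE chiM scalerBr scalerA /ca -!mulrA [chi x * (_ * _)]mulrCA.
rewrite !QE !(mulDa, mulaD) !(mulNa, mulaN, mulZa, mulaZ) RB mul1a mula1.
rewrite mul1a scalerA opprK !addrA -/ca -/cb.
by rewrite [RHS](ACl (1*4*7*2*5*3*(6*8))) /= subrr addr0.
Qed.

(** * The multiplication on the basis [a n] and its Rota-Baxter operators *)

Section HopfLambda.
Variables (C : comPzRingType) (lam : C).

Local Notation a n := (a_ C n).
Local Notation "x ** y" := (mu_lam lam (x \ot y))
  (at level 40, left associativity).

Lemma mu_lamE m n : a m ** a n = \sum_(k < m.+1)
  (lam ^+ k * ('C(m + n - k, m))%:R * ('C(m, k))%:R) *: a (m + n - k).
Proof. exact: tens_free_extE. Qed.

Lemma mu_lam1l : left_id (a 0) (fun x y => x ** y).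
Proof.
move=> x; elim/free_module_ind: x => [c x E|x y Ex Ey||n].
- by rewrite mulaZ E.
- by rewrite mulaD Ex Ey.
- by rewrite mula0.
- by rewrite mu_lamE big_ord1 subn0 add0n !bin0 !mulr1 scale1r.
Qed.

Lemma mu_lam1r : right_id (a 0) (fun x y => x ** y).
Proof.
move=> x; elim/free_module_ind: x => [c x E|x y Ex Ey||n].
- by rewrite mulZa E.
- by rewrite mulDa Ex Ey.
- by rewrite mul0a.
- rewrite mu_lamE big_ord_recl subn0 addn0 binn bin0 !mulr1 scale1r.
  (* For [k >= 1] the coefficient contains the binomial of [n - k] over [n], which is zero. *)
  rewrite big1 ?addr0 // => i _; rewrite bin_small ?mulr0 ?mul0r ?scale0r //.
  by rewrite /= /bump /= add1n ltn_subrL /=; case: n i => // -[].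
Qed.

Definition raise : {linear A_lam C -> A_lam C} := free_ext (fun n => a n.+1).

Lemma raiseE n : raise (a n) = a n.+1.
Proof. exact: free_extE. Qed.

(** Put [N = m + n + 1 - k] and compare coefficients of [a (m + n + 2 - k)]. Pascal's rule for
    ['C(N.+1, m.+1)], and then for ['C(m.+1, k)] in the part with ['C(N, m)], splits the left side
    into the three terms on the right. *)
Lemma raise_RB : rota_baxter (mu_lam lam) lam raise.
Proof.
apply: rota_baxter_free => m n b; rewrite /b -!/(a_ _ _) !raiseE !mu_lamE.
have raise_sum k F G : raise (\sum_(i < k) F i *: a (G i)) =
    \sum_(i < k) F i *: a (G i).+1.
  by rewrite linear_sum; apply: eq_bigr => i _; rewrite linearZZ raiseE.
rewrite !raise_sum scaler_sumr.
(* All sums are brought to the range [k < m.+2]. The family [F] is padded by its term at [k = m.+1],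
   which vanishes. *)
pose F k := (lam ^+ k * 'C(m + n.+1 - k, m)%:R * 'C(m, k)%:R) *: a (m + n.+2 - k).
pose G k := (lam ^+ k * 'C(m + n.+1 - k, m)%:R * 'C(m, k.-1)%:R) *: a (m + n.+2 - k).
rewrite [X in _ = X + _ + _](_ : _ = \sum_(k < m.+2) F k); last first.
  rewrite [RHS]big_ord_recr /= {2}/F (bin_small (ltnSn m)) mulr0 scale0r addr0.
  apply: eq_bigr => i _; rewrite /F.
  suff -> : ((m + n.+1 - i).+1 = m + n.+2 - i)%N by [].
  by have := ltn_ord i; lia.
(* The extra factor [lam] shifts the index by one. The term at [k = 0] must be set to zero by hand,
   because [0.-1 = 0] makes the binomial in [G 0] equal to one. *)
rewrite [X in _ = _ + X](_ : _ = \sum_(k < m.+2) if k == ord0 then 0 else G k);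
  last first.
  rewrite [RHS]big_ord_recl /= add0r; apply: eq_bigr => i _.
  rewrite scalerA /G /bump /= add1n exprS !mulrA addnS subSS.
  suff -> : ((m + n - i).+1 = m + n.+2 - i.+1)%N by [].
  by have := ltn_ord i; lia.
rewrite -!big_split /=; apply: eq_bigr => i _.
rewrite /F /G; have le_i : (i <= m.+1)%N by rewrite -ltnS.
have le_iN : (i <= (m + n).+1)%N by rewrite (leq_trans le_i) // ltnS leq_addr.
rewrite !addSn !addnS (subSn le_iN); set N := ((m + n).+1 - i)%N.
case: eqP => [->|/eqP ne0]; rewrite ?addr0 -!scalerDl; congr (_ *: _).
  by rewrite !bin0 !mulr1 -mulrDr -natrD binS addnC.
have -> : (i : nat) = i.-1.+1 by rewrite prednK // lt0n.
rewrite /= -!mulrA -!mulrDr -!natrM -!natrD; congr (_ * _%:R).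
by rewrite !binS !mulnDl !mulnDr; lia.
Qed.

Definition coef0 : {linear A_lam C -> C^o} :=
  free_ext (fun n => (n == 0)%:R : C^o).

Lemma coef0E n : coef0 (a n) = (n == 0)%:R.
Proof. exact: free_extE. Qed.

Lemma coef0_raise x : coef0 (raise x) = 0.
Proof.
elim/free_module_ind: x => [c x E|x y Ex Ey||n].
- by rewrite [raise _]linearZZ [LHS]linearZZ E scaler0.
- by rewrite !linearD Ex Ey addr0.
- by rewrite !linear0.
- by rewrite raiseE coef0E.
Qed.

(** If both indices are positive, [raise_RB] puts the product in the range of [raise], where [coef0]
    vanishes; otherwise one factor is the unit. This makes [coef0] the character required by
    [rota_baxter_augment]. *)
Lemma coef0M x y : coef0 (x ** y) = (coef0 x : C) * coef0 y.
Proof.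
elim/free_module_ind: x => [c x E|x z Ex Ez||m].
- by rewrite mulZa ![coef0 (_ *: _)]linearZZ E /GRing.scale /= mulrA.
- by rewrite mulDa !linearD Ex Ez mulrDl.
- by rewrite mul0a !linear0 mul0r.
elim/free_module_ind: y => [c y E|y z Ey Ez||n].
- by rewrite mulaZ ![coef0 (_ *: _)]linearZZ E /GRing.scale /= mulrCA.
- by rewrite mulaD !linearD Ey Ez mulrDr.
- by rewrite mula0 !linear0 mulr0.
case: m n => [|m] [|n].
- by rewrite mu_lam1l coef0E mul1r.
- by rewrite mu_lam1l !coef0E mul1r.
- by rewrite mu_lam1r !coef0E mulr1.
rewrite -!/(a_ _ _) -!raiseE raise_RB -linearZZ -!linearD.
by rewrite !coef0_raise mulr0.
Qed.

(* The operator Q of the header, expressed in the basis [a n]. *)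
Definition shift : {linear A_lam C -> A_lam C} :=
  free_ext (fun n => if n is 0 then a 1 - lam *: a 0 else a n.+1).

Lemma shift0 : shift (a 0) = a 1 - lam *: a 0.
Proof. exact: free_extE. Qed.

Lemma shiftS n : shift (a n.+1) = a n.+2.
Proof. exact: free_extE. Qed.

Lemma shiftE x : shift x = raise x - (lam * coef0 x) *: a 0.
Proof.
elim/free_module_ind: x => [c x E|x z Ex Ez||[|n]].
- rewrite [shift _]linearZZ [raise _]linearZZ [coef0 _]linearZZ E scalerBr.
  by rewrite scalerA mulrCA.
- by rewrite [shift _]linearD [raise _]linearD [coef0 _]linearD Ex Ez mulrDr
    scalerDl opprD addrACA.
- by rewrite !linear0 mulr0 scale0r subr0.
- by rewrite shift0 raiseE coef0E mulr1.
- by rewrite shiftS raiseE coef0E mulr0 scale0r subr0.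
Qed.

Lemma shift_RB : rota_baxter (mu_lam lam) lam shift.
Proof.
apply: (rota_baxter_augment mu_lam1l mu_lam1r coef0M _ coef0_raise shiftE).
  exact: coef0E.
exact: raise_RB.
Qed.

(** The basis is reached from [a 0] by [a 1 = lam *: a 0 + shift (a 0)], after which [shift] is the
    successor on indices. *)
Lemma shift_ind (P : A_lam C -> Prop) :
  (forall c x y, P x -> P y -> P (c *: x + y)) -> P (a 0) ->
  (forall x, P x -> P (shift x)) -> forall x, P x.
Proof.
move=> PL P1 PQ.
have P0 : P 0 by rewrite -(addNr (a 0)) -scaleN1r; exact: PL.
elim/free_module_ind => [c x Px|x y Px Py||n].
- by rewrite -[_ *: x]addr0; exact: PL.
- by rewrite -[x]scale1r; exact: PL.
- exact: P0.
have Pa1 : P (a 1).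
  have -> : a 1 = lam *: a 0 + shift (a 0) by rewrite shift0 addrC subrK.
  by apply: PL => //; exact: PQ.
case: n => // n; elim: n => // n IHn.
by have := PQ _ IHn; rewrite -!/(a_ _ _) shiftS.
Qed.

(** * Comultiplication and counit against the shift *)

Lemma Delta_lamE n : Delta_lam lam (a n) =
  \sum_(k < n.+1) \sum_(i < (n - k).+1)
    (- lam) ^+ k *: (a i \ot a (n - k - i)).
Proof. exact: free_extE. Qed.

Lemma Delta_lam0 : Delta_lam lam (a 0) = a 0 \ot a 0.
Proof. by rewrite Delta_lamE !big_ord1 scale1r. Qed.

(** This is the coefficient of [t^(n+1)] in [(1 + lam t) Delta a(t) = a(t) \ot a(t)]; it replaces
    the double sum by a recursion. *)
Lemma Delta_lamS n : Delta_lam lam (a n.+1) =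
  \sum_(i < n.+2) a i \ot a (n.+1 - i) - lam *: Delta_lam lam (a n).
Proof.
rewrite !Delta_lamE big_ord_recl subn0; congr (_ + _).
  by apply: eq_bigr => i _; rewrite scale1r.
rewrite -scaleNr scaler_sumr; apply: eq_bigr => k _.
rewrite scaler_sumr lift0 subSS; apply: eq_bigr => i _.
by rewrite exprS scalerA.
Qed.

Lemma Delta_lamC x : tens_swap (Delta_lam lam x) = Delta_lam lam x.
Proof.
elim/free_module_ind: x => [c x E|x y Ex Ey||n].
- by rewrite [Delta_lam _ _]linearZZ [LHS]linearZZ; congr (_ *: _).
- by rewrite [Delta_lam _ _]linearD [LHS]linearD; congr (_ + _).
- by rewrite !linear0.
rewrite Delta_lamE linear_sum; apply: eq_bigr => k _.
rewrite linear_sum [RHS](reindex_inj rev_ord_inj) /=; apply: eq_bigr => i _.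
rewrite [LHS]linearZZ /= tens_swapE.
by rewrite subSS subKn // -ltnS.
Qed.

Lemma Delta_lam_shift x : Delta_lam lam (shift x) =
  a 0 \ot shift x + tens_map shift idfun (Delta_lam lam x).
Proof.
elim/free_module_ind: x => [c x E|x y Ex Ey||n].
- rewrite [shift _]linearZZ ![Delta_lam _ _]linearZZ E tensZr scalerDr.
  congr (_ + _); symmetry; exact: linearZZ.
- rewrite [shift (_ + _)]linearD ![Delta_lam _ (_ + _)]linearD Ex Ey tensDr.
  by rewrite [in RHS]linearD addrACA.
- by rewrite !linear0 tens0r addr0.
have Q1E m : tens_map shift idfun (Delta_lam lam (a m)) =
    Delta_lam lam (a m.+1) - a 0 \ot a m.+1.
  (* The last term comes from the exceptional value [shift (a 0) = a 1 - lam *: a 0]. In the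
     induction on [m] it cancels the boundary term produced by [Delta_lamS]. *)
  have Q1sum k : tens_map shift idfun (\sum_(i < k.+1) a i \ot a (k - i)) =
      \sum_(i < k.+2) a i \ot a (k.+1 - i) - a 0 \ot a k.+1
      - lam *: (a 0 \ot a k).
    rewrite linear_sum big_ord_recl [in RHS]big_ord_recl !subn0.
    rewrite [X in _ = X - _ - _]addrC addrK /= tens_mapE shift0.
    rewrite tensDl -scaleNr tensZl scaleNr [in RHS]big_ord_recl [RHS]addrAC.
    rewrite !subSS subn0; congr (_ + _); apply: eq_bigr => i _.
    by rewrite tens_mapE /bump /= !add1n shiftS subSS.
  elim: m => [|m IHm].
    rewrite Delta_lamS Delta_lam0 tens_mapE shift0 !big_ord_recl big_ord0 addr0.
    by rewrite tensDl -scaleNr tensZl scaleNr addrAC; congr (_ - _);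
      rewrite addrC addKr.
  have Q1BZ (f : {linear A_lam C ⊗ A_lam C -> A_lam C ⊗ A_lam C}) s t :
      f (s - lam *: t) = f s - lam *: f t by rewrite linearB linearZZ.
  rewrite Delta_lamS [LHS]Q1BZ /= Q1sum IHm.
  rewrite scalerBr opprB addrA subrK [in RHS]Delta_lamS.
  by rewrite addrAC.
rewrite -!/(a_ _ _) Q1E; case: n => [|n].
  rewrite shift0 linearB [Delta_lam _ (_ *: _)]linearZZ Delta_lam0.
  rewrite tensDr -[- (lam *: a 0)]scaleNr tensZr scaleNr.
  by rewrite [RHS]addrC addrA subrK.
by rewrite shiftS addrC subrK.
Qed.

Lemma eps_lamE n :
  eps_lam lam (a n) = match n with 0 => 1 | 1 => lam | _ => 0 end :> C^o.
Proof. exact: free_extE. Qed.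

Lemma eps_lam_shift x : eps_lam lam (shift x) = 0.
Proof.
elim/free_module_ind: x => [c x E|x y Ex Ey||[|n]].
- by rewrite [shift _]linearZZ [LHS]linearZZ E scaler0.
- by rewrite !linearD Ex Ey addr0.
- by rewrite !linear0.
- rewrite shift0 linearB [eps_lam _ (_ *: _)]linearZZ !eps_lamE.
  by rewrite /GRing.scale /= mulr1 subrr.
- by rewrite shiftS eps_lamE.
Qed.

(** * The antipode against the shift *)

Lemma S_lamE n : S_lam lam (a n) = (-1) ^+ n *: \sum_(v < n.+1)
  ((binz (n%:Z - 3) (n - v))%:~R * lam ^+ (n - v)) *: a v.
Proof. exact: free_extE. Qed.

Lemma S_lam0 : S_lam lam (a 0) = a 0.
Proof.
by rewrite S_lamE big_ord1 subn0 (binz_neg 2 0) !mulr1 !scale1r.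
Qed.

Lemma S_lam1 : S_lam lam (a 1) = (lam *+ 2) *: a 0 - a 1.
Proof.
rewrite S_lamE !big_ord_recl big_ord0.
(* The upper argument [1 - 3] evaluates to [Negz 1], the form that [binz_neg] expects. *)
rewrite -[LHS]/(- 1 *: (((binz (Negz 1) 1)%:~R * lam) *: a 0 +
  (((binz (Negz 1) 0)%:~R * 1) *: a 1 + 0))) !binz_neg.
rewrite -[_ * 'C(1 + 1, 1)%:Z]/(- 2%:Z) -[_ * 'C(1 + 0, 0)%:Z]/(1%:Z).
rewrite addr0 mulr1 scale1r scaleN1r opprD -scaleNr -mulNr -mulrNz opprK.
by rewrite -mulr_natl.
Qed.

Lemma S_lam2 : S_lam lam (a 2) = a 2 - lam *: a 1 + lam ^+ 2 *: a 0.
Proof.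
rewrite S_lamE !big_ord_recl big_ord0.
rewrite -[LHS]/((- 1 * - 1) *: (((binz (Negz 0) 2)%:~R * lam ^+ 2) *: a 0 +
  (((binz (Negz 0) 1)%:~R * lam) *: a 1 +
   (((binz (Negz 0) 0)%:~R * 1) *: a 2 + 0)))) !binz_neg.
rewrite -[_ * 'C(0 + 2, 2)%:Z]/(1%:Z) -[_ * 'C(0 + 1, 1)%:Z]/(- 1%:Z).
rewrite mulrNN !mul1r !scale1r addr0 mulN1r scaleNr.
by rewrite [RHS]addrC [in RHS](addrC (a 2)).
Qed.

(** From index 3 on the upper argument is the natural number [n], so ordinary binomials suffice. The
    term at [a 0] has coefficient ['C(n, n.+3) = 0], so [shift] acts on the result as a plain
    successor. *)
Lemma S_lam3 n : S_lam lam (a n.+3) = (-1) ^+ n.+1 *: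
  \sum_(v < n.+3) ('C(n, n.+2 - v)%:R * lam ^+ (n.+2 - v)) *: a v.+1.
Proof.
rewrite S_lamE big_ord_recl; have -> : n.+3%:Z - 3 = n by lia.
rewrite binz_nat subn0 bin_small ?mul0r ?scale0r ?add0r; last by lia.
congr (_ *: _); first by rewrite !exprS !mulN1r opprK.
by apply: eq_bigr => v _; rewrite binz_nat lift0 subSS.
Qed.

(** Indices 0, 1 and 2 are computed directly: there the upper argument of the binomial is negative.
    From index 3 on, [eps_lam] vanishes and the identity is Pascal's rule, one summand coming from
    [shift] and the other from the factor [lam]. *)
Lemma S_lam_shift x : S_lam lam (shift x) =
  (lam * eps_lam lam x) *: a 0 - shift (S_lam lam x) - lam *: S_lam lam x.
Proof.
elim/free_module_ind: x => [c x E|x y Ex Ey||[|[|[|n]]]].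
- rewrite [shift (_ *: _)]linearZZ ![S_lam _ (_ *: _)]linearZZ E.
  rewrite [eps_lam _ (_ *: _)]linearZZ [shift (c *: _)]linearZZ.
  by rewrite !scalerBr !scalerA mulrCA [lam * c]mulrC.
- rewrite [shift (x + y)]linearD ![S_lam _ (_ + _)]linearD Ex Ey.
  rewrite [eps_lam _ (_ + _)]linearD [shift (_ + _)]linearD.
  rewrite mulrDr scalerDl scalerDr !opprD.
  by rewrite [LHS]addrACA [X in X + _ = _]addrACA.
- by rewrite !(linear0, mulr0, scale0r, subr0).
- rewrite shift0 linearB [S_lam _ (_ *: _)]linearZZ S_lam0 S_lam1 shift0 eps_lamE.
  by rewrite mulr1 opprB mulr2n scalerDl addrA.
- rewrite shiftS S_lam2 S_lam1 linearB [shift (_ *: _)]linearZZ shift0 shiftS eps_lamE.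
  rewrite !scalerBr !scalerA mulrnAl mulrnAr -!scalerMnl expr2 !opprB !addrA.
  rewrite !mulr2n [RHS](ACl (2*(5*6)*1*(3*4*7))) /= subrr addr0 opprD.
  by rewrite addrNK.
- rewrite shiftS S_lam3 S_lam2 linearD linearB ![shift (_ *: _)]linearZZ.
  rewrite shift0 !shiftS eps_lamE !big_ord_recl big_ord0.
  rewrite -[LHS]/(- 1 *: ((0%:R * lam ^+ 2) *: a 1 + ((0%:R * lam) *: a 2 +
    ((1%:R * 1) *: a 3 + 0)))).
  rewrite !mul0r !scale0r !add0r addr0 mulr1 scale1r scaleN1r mulr0 scale0r sub0r.
  rewrite -opprD; congr (- _); rewrite !scalerBr !scalerDr scalerN !scalerA.
  rewrite expr2 !mulrA !addrA [RHS](ACl (1*(2*5)*(3*6)*(4*7))) /=.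
  by rewrite !addNr subrr !addr0.
rewrite shiftS !S_lam3 eps_lamE mulr0 scale0r sub0r exprS mulN1r scaleNr.
rewrite [shift _]linearZZ scalerA [lam * _]mulrC -scalerA -opprD -scalerDr.
congr (- (_ *: _)).
(* These are the coefficients after the shift, reindexed to the range of the left side; the added
   term [F 0] is zero. *)
pose F v := ('C(n, n.+3 - v)%:R * lam ^+ (n.+3 - v)) *: a v.+1.
have -> : shift (\sum_(v < n.+3) ('C(n, n.+2 - v)%:R * lam ^+ (n.+2 - v)) *: a v.+1)
    = \sum_(v < n.+4) F v.
  rewrite [RHS]big_ord_recl {1}/F subn0 bin_small ?mul0r ?scale0r ?add0r; last by lia.
  rewrite linear_sum; apply: eq_bigr => v _.
  by rewrite /F lift0 subSS [LHS]linearZZ; congr (_ *: _); exact: shiftS.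
rewrite [LHS]big_ord_recr [X in _ = X + _]big_ord_recr /F /= !subnn !bin0 addrAC.
congr (_ + _); rewrite scaler_sumr -big_split; apply: eq_bigr => v _ /=.
rewrite subSn; last by rewrite -ltnS.
by rewrite binS natrD mulrDl scalerDl scalerA mulrCA -exprS.
Qed.
End HopfLambda.

(** * The general criterion applied to [shift] and [a 0] *)

Theorem theorem1p1 (C : comPzRingType) (lambda : C) :
  is_Hopf_algebra (mu_lam lambda) (@eta_lam C) (Delta_lam lambda)
    (eps_lam lambda) (S_lam lambda).
Proof.
apply: (rb_Hopf (lam := lambda) (Q := shift lambda) (one := a_ C 0)).
- exact: shift_ind.
- by [].
- exact: mu_lam1l.
- exact: mu_lam1r.
- exact: shift_RB.
- exact: Delta_lam0.
- exact: Delta_lam_shift.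
- exact: Delta_lamC.
- exact: eps_lamE.
- exact: eps_lam_shift.
- exact: S_lam0.
- exact: S_lam_shift.
Qed.
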